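(* For all integers $i,j\ge 0$, the partial descent set statistic $\mathrm{Des}_{i,j}$ is shuffle-compatible.
   Context: A permutation of length $n$ is a sequence $\pi=\pi_1\cdots\pi_n$ of $n$ distinct positive integers. A permutation statistic is a function $\mathrm{st}$ on permutations such that $\mathrm{st}(\pi)=\mathrm{st}(\sigma)$ whenever $\pi$ and $\sigma$ have the same relative order (i.e., the same standardization). Two permutations are disjoint if they share no letters; for disjoint $\pi,\sigma$, $S(\pi,\sigma)$ is the set of permutations of length $|\pi|+|\sigma|$ containing both $\pi$ and $\sigma$ as subsequences (shuffles). A statistic $\mathrm{st}$ is shuffle-compatible if for any disjoint $\pi,\sigma$ the multiset $\{\mathrm{st}(\tau):\tau\in S(\pi,\sigma)\}$ depends only on $\mathrm{st}(\pi)$, $\mathrm{st}(\sigma)$, $|\pi|$ and $|\sigma|$. The descent set of $\pi$ of length $n$ is $\mathrm{Des}(\pi)=\{k\in[n-1]:\pi_k>\pi_{k+1}\}$, and the partial descent set is $\mathrm{Des}_{i,j}(\pi)=\mathrm{Des}(\pi)\cap(\{1,2,\dots,i\}\cup\{n-1,n-2,\dots,n-j\})$. *)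

(* Defs.v *)
From mathcomp Require Import all_boot finmap.

Set Implicit Arguments.
Unset Strict Implicit.
Unset Printing Implicit Defensive.

Local Open Scope fset_scope.
Local Open Scope nat_scope.

(* A permutation in the sense of shuffle-compatibility: any word of distinct
   positive integers, not necessarily with letters 1, ..., n. *)
Definition is_perm (p : seq nat) : bool := uniq p && all (fun x => 0 < x) p.

(* The k-th smallest letter of p is replaced by k. *)
Definition standardization (p : seq nat) : seq nat :=
  [seq count (fun y => y <= x) p | x <- p].

(* The values on words that are not permutations are irrelevant. *)
Record statistic (T : Type) := Statistic {
  stat_fun :> seq nat -> T;
  stat_std : forall p q : seq nat, is_perm p -> is_perm q ->
    standardization p = standardization q -> stat_fun p = stat_fun q }.

Definition disjoint_perms (p q : seq nat) : bool := ~~ has (mem p) q.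

(* A duplicate-free enumeration of S(p, q), see [uniq_shuffles] and
   [mem_shuffles]. *)
Definition shuffles (p q : seq nat) : seq (seq nat) :=
  [seq t <- permutations (p ++ q) | subseq p t && subseq q t].

Lemma uniq_shuffles (p q : seq nat) : uniq (shuffles p q).
Proof. by rewrite filter_uniq ?permutations_uniq. Qed.

Lemma mem_shuffles (p q t : seq nat) :
  is_perm p -> is_perm q -> disjoint_perms p q ->
  t \in shuffles p q =
    [&& is_perm t, size t == size p + size q, subseq p t & subseq q t].
Proof.
move=> /andP[up pp] /andP[uq pq] dpq.
have upq : uniq (p ++ q) by rewrite cat_uniq up uq andbT; apply: dpq.
rewrite mem_filter mem_permutations; apply/idP/idP.
  move=> /andP[/andP[sp sq] e]; rewrite sp sq /is_perm (perm_uniq e) upq.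
  by rewrite (perm_all _ e) all_cat pp pq (perm_size e) size_cat eqxx.
move=> /and4P[/andP[ut _] /eqP st sp sq]; rewrite sp sq /= perm_sym.
apply: uniq_perm => //; apply: (uniq_min_size upq _ _).2.
  by move=> x; rewrite mem_cat => /orP[]; apply: mem_subseq.
by rewrite size_cat st.
Qed.

Definition shuffle_compatible (T : eqType) (st : statistic T) : Prop :=
  forall p q p' q' : seq nat,
    is_perm p -> is_perm q -> disjoint_perms p q ->
    is_perm p' -> is_perm q' -> disjoint_perms p' q' ->
    st p = st p' -> st q = st q' -> size p = size p' -> size q = size q' ->
    perm_eq [seq st t | t <- shuffles p q] [seq st t | t <- shuffles p' q'].

(* Positions are numbered from 1, so that the letter p_k is [nth 0 p k.-1]. *)
Definition Des (p : seq nat) : {fset nat} :=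
  [fset k in iota 1 (size p).-1 | nth 0 p k < nth 0 p k.-1].

(* When size p <= l, truncated subtraction turns the nonpositive number
   size p - l into 0, which never belongs to [Des p]. *)
Definition pdes (i j : nat) (p : seq nat) : {fset nat} :=
  Des p `&` ([fset k in iota 1 i] `|` [fset size p - l | l in iota 1 j]).

Lemma count_leq_lt (p : seq nat) (x y : nat) : y \in p ->
  (count (fun z => z <= x) p < count (fun z => z <= y) p) = (x < y).
Proof.
move=> yp; case: (ltnP x y) => [xy | yx]; last first.
  apply/negbTE; rewrite -leqNgt; apply: sub_count => z /= zy.
  exact: leq_trans yx.
have := count_predUI (fun z => z <= x) (pred1 y) p.
rewrite (eq_count (a2 := pred0) (a1 := predI _ _)); last first.
  by move=> z /=; apply/andP => -[zx /eqP ezy]; rewrite ezy leqNgt xy in zx.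
rewrite count_pred0 addn0 => e.
have c : 0 < count_mem y p by rewrite -has_count has_pred1.
apply: (@leq_trans (count (predU (fun z => z <= x) (pred1 y)) p)).
  by rewrite e -addn1 leq_add2l.
by apply: sub_count => z /= /orP[zx | /eqP-> //]; apply: leq_trans (ltnW xy).
Qed.

Lemma nth_standardization (p : seq nat) (k l : nat) :
  k < size p -> l < size p ->
  (nth 0 (standardization p) k < nth 0 (standardization p) l)
  = (nth 0 p k < nth 0 p l).
Proof.
by move=> kp lp; rewrite !(nth_map 0) // count_leq_lt // mem_nth.
Qed.

Lemma pdes_std (i j : nat) (p q : seq nat) : is_perm p -> is_perm q ->
  standardization p = standardization q -> pdes i j p = pdes i j q.
Proof.
move=> _ _ e.
have es : size p = size q.
  by rewrite -(size_map (fun x => count (fun y => y <= x) p)) -/(standardization p)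
             e size_map.
rewrite /pdes es; congr (_ `&` _); apply/fsetP => k; rewrite !inE /= es.
case: (boolP (k \in iota 1 (size q).-1)) => //=; rewrite mem_iota => /andP[k1 k2].
have kq : k < size q by case: (size q) k2 k1 => [|n] //=; case: k.
have kq' : k.-1 < size q by apply: leq_ltn_trans kq; apply: leq_pred.
by rewrite -nth_standardization ?es // e nth_standardization.
Qed.

Definition partial_Des (i j : nat) : statistic {fset nat} :=
  @Statistic _ (pdes i j) (@pdes_std i j).

(* Main.v *)
(* The statistic of the shuffles is unchanged when the relative order of a letter
   x of p and a letter y of q with no letter between them in value is reversed:
   shuffles in which x and y are adjacent are kept, in all others x and y are
   renamed. Repeating this, one may assume that all letters of p are smaller than
   all letters of q. Then the order of two adjacent letters of a shuffle that come
   from different words is fixed, and a descent of p (or q) outside the window of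
   [pdes] moves to a position of the shuffle that is again outside the window,
   since at least as many letters precede it and at least as many follow it. So
   exchanging the letters of p and q for those of p' and q' keeps the statistic. *)
Require Import Defs.
From mathcomp Require Import all_boot finmap zify.

Set Implicit Arguments.
Unset Strict Implicit.
Unset Printing Implicit Defensive.

(** * Bijections between lists of shuffles, and membership in [pdes] *)

Lemma perm_map_inverse (T U : eqType) (f g : T -> T) (st : T -> U) (s1 s2 : seq T) :
  uniq s1 -> uniq s2 ->
  {in s1, forall t, f t \in s2} -> {in s2, forall t, g t \in s1} ->
  {in s1, cancel f g} -> {in s2, cancel g f} ->
  {in s1, forall t, st (f t) = st t} ->
  perm_eq (map st s1) (map st s2).
Proof.
move=> u1 u2 f12 g21 fK gK stf.
have e : perm_eq (map f s1) s2.
  apply: uniq_perm => //; first by rewrite map_inj_in_uniq //; apply: can_in_inj fK.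
  move=> t; apply/mapP/idP => [[r r1 ->]|t2]; first exact: f12.
  by exists (g t); rewrite ?g21 ?gK.
rewrite -(permPr (perm_map st e)) -map_comp.
by rewrite ((eq_in_map (st \o f) st s1).1 stf).
Qed.

Lemma shuffles_uniq (p q t : seq nat) : uniq (p ++ q) -> t \in shuffles p q -> uniq t.
Proof. by rewrite mem_filter mem_permutations => u /andP[_ /perm_uniq ->]. Qed.

Lemma pair_in_seq (t : seq nat) (k : nat) : k.+1 < size t ->
  t = take k t ++ [:: nth 0 t k; nth 0 t k.+1] ++ drop k.+2 t.
Proof. by move=> kt; rewrite /= -!drop_nth ?cat_take_drop // ltnW. Qed.

(** Indices start at 0: [k] stands for the descent position [k.+1], and the second disjunct says
    that this position is at least [n - j]. *)
Definition in_window (i j n k : nat) : bool := (k < i) || (n - k.+1 <= j).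

Lemma mem_pdes (i j : nat) (p : seq nat) (k : nat) :
  (k.+1 \in pdes i j p) =
    [&& k.+1 < size p, in_window i j (size p) k & nth 0 p k.+1 < nth 0 p k].
Proof.
rewrite /pdes /Des !inE /= mem_iota /=.
have -> : (k.+1 < 1 + (size p).-1) = (k.+1 < size p) by lia.
case: (ltnP k.+1 (size p)) => //= kp; rewrite andbC; congr (_ && _).
rewrite /in_window; congr (_ || _); first by rewrite mem_iota; lia.
apply/idP/idP => [/imfsetP[l /=]|le_j].
  by rewrite mem_iota; lia.
have {1}-> : k.+1 = size p - (size p - k.+1) by lia.
by rewrite in_imfset //= mem_iota; lia.
Qed.

Lemma pdesP (i j : nat) (p q : seq nat) : size p = size q ->
  (forall k, k.+1 < size p -> in_window i j (size p) k ->
     (nth 0 p k.+1 < nth 0 p k) = (nth 0 q k.+1 < nth 0 q k)) <->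
  pdes i j p = pdes i j q.
Proof.
move=> spq; split=> [same | e k kp kw].
  apply/fsetP => -[|k]; first by rewrite /pdes /Des !inE /= !mem_iota.
  rewrite !mem_pdes -spq; case: ltnP => //= kp.
  by case: (boolP (in_window _ _ _ _)) => //= kw; apply: same.
by have := mem_pdes i j p k; rewrite e mem_pdes -spq kp kw /= => ->.
Qed.

(** * Exchanging two letters of neighbouring values *)

Definition swap (x y z : nat) : nat := if z == x then y else if z == y then x else z.

Lemma swapC (x y : nat) : swap x y =1 swap y x.
Proof. by move=> z; rewrite /swap; do 2!case: eqP => // ->. Qed.

Lemma swapK (x y : nat) : involutive (swap x y).
Proof.
move=> z; rewrite /swap; case: (eqVneq z x) => [->|zx]; last case: (eqVneq z y) => [->|zy].
- by rewrite eqxx; case: eqP.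
- by rewrite eqxx.
- by rewrite (negbTE zx) (negbTE zy).
Qed.

Lemma swap_inj (x y : nat) : injective (swap x y).
Proof. exact: inv_inj (swapK x y). Qed.

Lemma swapL (x y : nat) : swap x y x = y.
Proof. by rewrite /swap eqxx. Qed.

Lemma swapR (x y : nat) : swap x y y = x.
Proof. by rewrite swapC swapL. Qed.

Lemma map_swapK (x y : nat) : involutive (map (swap x y)).
Proof. exact/mapK/swapK. Qed.

Lemma map_swap_id (x y : nat) (s : seq nat) :
  x \notin s -> y \notin s -> map (swap x y) s = s.
Proof.
move=> xs ys; apply: map_id_in => z zs; rewrite /swap.
by rewrite (negbTE (memPn xs z zs)) (negbTE (memPn ys z zs)).
Qed.

Definition adjacent (x y : nat) (t : seq nat) : bool :=
  infix [:: x; y] t || infix [:: y; x] t.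

Lemma adjacentC (x y : nat) (t : seq nat) : adjacent x y t = adjacent y x t.
Proof. by rewrite /adjacent orbC. Qed.

Lemma adjacent_map_swap (x y : nat) (t : seq nat) :
  adjacent x y (map (swap x y) t) = adjacent x y t.
Proof.
have imp s : adjacent x y s -> adjacent x y (map (swap x y) s).
  case/orP=> /infixP[A [B ->]]; rewrite !map_cat /= swapL swapR; apply/orP.
    by right; apply/infixP; do 2 eexists.
  by left; apply/infixP; do 2 eexists.
by apply/idP/idP => /imp //; rewrite map_swapK.
Qed.

Definition exchange (x y : nat) (t : seq nat) : seq nat :=
  if adjacent x y t then t else map (swap x y) t.

Lemma exchangeK (x y : nat) : involutive (exchange x y).
Proof.
move=> t; rewrite /exchange; case: (boolP (adjacent x y t)) => [->//|nt].
by rewrite adjacent_map_swap (negbTE nt) map_swapK.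
Qed.

(** Nothing stands between [x] and [y] in [t], so using [y] in place of [x] keeps the order relative
    to all other letters of [p]. *)
Lemma subseq_map_swap (x y : nat) (p t : seq nat) :
  uniq t -> adjacent x y t -> x \in p -> y \notin p -> subseq p t ->
  subseq (map (swap x y) p) t.
Proof.
move=> ut adj xp yp /subseq_uniqP-/(_ ut) pE.
(* Both orders of the pair are treated at once, [s] being the pair. As [t] is duplicate-free, [x]
   and [y] do not occur in [A] or [B], so the swap acts on [s] alone. *)
have split_at A s B : t = A ++ s ++ B -> perm_eq s [:: x; y] ->
    filter (mem p) s = [:: x] -> subseq (map (swap x y) p) t.
  move=> tE sE fs; have us : uniq (s ++ A ++ B) by rewrite uniq_catCA -tE.
  have xs : x \in s by rewrite (perm_mem sE) inE eqxx.
  have ys : y \in s by rewrite (perm_mem sE) !inE eqxx orbT.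
  move: us; rewrite cat_uniq => /and3P[_ /hasPn/= nAB _].
  have notAB z : z \in s -> (z \notin A) && (z \notin B).
    move=> zs; rewrite -negb_or -mem_cat; apply/negP => /nAB; by rewrite zs.
  have /andP[xA xB] := notAB x xs; have /andP[yA yB] := notAB y ys.
  have fid C : x \notin C -> y \notin C ->
      map (swap x y) (filter (mem p) C) = filter (mem p) C.
    by move=> xC yC; rewrite map_swap_id // mem_filter ?(negbTE xC) ?(negbTE yC) ?andbF.
  rewrite pE tE !filter_cat fs !map_cat /= swapL !fid //.
  apply: cat_subseq; first exact: filter_subseq.
  by apply: (@cat_subseq _ [:: y]); rewrite ?sub1seq ?filter_subseq.
case/orP: adj => /infixP[A [B tE]]; apply: (split_at A _ B tE) => //=.
- by rewrite xp (negbTE yp).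
- by rewrite (perm_catC [:: y] [:: x]).
- by rewrite xp (negbTE yp).
Qed.

Lemma mem_exchange_shuffles (x y : nat) (p q t : seq nat) :
  uniq (p ++ q) -> x \in p -> y \in q -> t \in shuffles p q ->
  exchange x y t \in shuffles (map (swap x y) p) (map (swap x y) q).
Proof.
move=> u xp yq tpq; have ut := shuffles_uniq u tpq.
move: tpq; rewrite !mem_filter !mem_permutations => /andP[/andP[pt qt] e].
have pm : perm_eq (map (swap x y) t) (map (swap x y) p ++ map (swap x y) q).
  by rewrite -map_cat perm_map.
move: u; rewrite cat_uniq => /and3P[_ /hasPn/= dis _].
have yp : y \notin p := dis _ yq.
have xq : x \notin q by apply: contraTN xp => /dis.
rewrite /exchange; case: (boolP (adjacent x y t)) => adj; last first.
  by rewrite !map_subseq.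
rewrite subseq_map_swap //= (eq_map (swapC x y) q).
rewrite subseq_map_swap // 1?adjacentC //= -(eq_map (swapC x y) q) -(permPr pm).
apply: uniq_perm => //; first by rewrite (map_inj_uniq (@swap_inj x y)).
(* [t] contains both [x] and [y], so the swap only permutes its letters. *)
have sub_t z : z \in t -> swap x y z \in t.
  rewrite /swap; case: eqP => _; first by rewrite (mem_subseq qt yq).
  by case: eqP => _ //; rewrite (mem_subseq pt xp).
move=> z; apply/idP/mapP => [zt|[w wt ->]]; last exact: sub_t.
by exists (swap x y z); rewrite ?sub_t ?swapK.
Qed.

(** No letter of [t] lies strictly between [x] and [y] in value, so the swap can alter only the
    comparison of [x] with [y], and these are never neighbours in [t]. *)
Lemma pdes_map_swap (i j x y : nat) (t : seq nat) :
  {in t, forall z, (x < z) = (y < z) \/ z = x \/ z = y} ->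
  ~~ adjacent x y t -> pdes i j (map (swap x y) t) = pdes i j t.
Proof.
move=> btw nadj; apply/pdesP; rewrite size_map // => k kt _.
rewrite !(nth_map 0) ?(ltnW kt) //.
have := btw _ (mem_nth 0 kt); have := btw _ (mem_nth 0 (ltnW kt)).
have := pair_in_seq kt; move: (nth 0 t k) (nth 0 t k.+1) => a b tE.
have nxy : ~ (a = x /\ b = y).
  by case=> ax by_; case/negP: nadj; apply/orP; left; apply/infixP;
     do 2 eexists; rewrite {1}tE ax by_.
have nyx : ~ (a = y /\ b = x).
  by case=> ay bx; case/negP: nadj; apply/orP; right; apply/infixP;
     do 2 eexists; rewrite {1}tE ay bx.
rewrite /swap; case: (a =P x); case: (a =P y); case: (b =P x); case: (b =P y); lia.
Qed.

Lemma pdes_exchange (i j x y : nat) (t : seq nat) :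
  {in t, forall z, (x < z) = (y < z) \/ z = x \/ z = y} ->
  pdes i j (exchange x y t) = pdes i j t.
Proof.
by move=> btw; rewrite /exchange; case: ifPn => // /pdes_map_swap; apply.
Qed.

Lemma perm_pdes_exchange (i j x y : nat) (p q : seq nat) :
  uniq (p ++ q) -> x \in p -> y \in q ->
  {in p ++ q, forall z, (x < z) = (y < z) \/ z = x \/ z = y} ->
  perm_eq (map (pdes i j) (shuffles p q))
    (map (pdes i j) (shuffles (map (swap x y) p) (map (swap x y) q))).
Proof.
move=> u xp yq btw; have u' : uniq (map (swap x y) p ++ map (swap x y) q).
  by rewrite -map_cat (map_inj_uniq (@swap_inj x y)).
apply: (@perm_map_inverse _ _ (exchange x y) (exchange x y)); rewrite ?uniq_shuffles //.
- by move=> t; apply: mem_exchange_shuffles.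
- move=> t tpq; have yp' : y \in map (swap x y) p.
    by apply/mapP; exists x; rewrite ?swapL.
  have xq' : x \in map (swap x y) q by apply/mapP; exists y; rewrite ?swapR.
  (* The way back is the same lemma with [x] and [y] interchanged: swapping again restores [p] and
     [q]. *)
  have := mem_exchange_shuffles u' yp' xq' tpq.
  rewrite !(eq_map (swapC y x)) !map_swapK /exchange adjacentC.
  by rewrite (eq_map (swapC y x)).
- by move=> t _; apply: exchangeK.
- by move=> t _; apply: exchangeK.
- move=> t tpq; apply: pdes_exchange => z zt; apply: btw.
  by move: tpq; rewrite mem_filter mem_permutations => /andP[_ /perm_mem <-].
Qed.

(** * Making all letters of one word smaller than those of the other *)

Lemma sumn_map_swap (x y : nat) (p : seq nat) :
  y < x -> x \in p -> y \notin p -> sumn (map (swap x y) p) < sumn p.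
Proof.
move=> yx; elim: p => //= a p IH; rewrite !inE negb_or => xap /andP[ya yp].
have le : sumn (map (swap x y) p) <= sumn p.
  case: (boolP (x \in p)) => [xp|xp]; first exact/ltnW/IH.
  by rewrite map_swap_id.
rewrite {1}/swap eq_sym; case: eqP xap => /= [xa _|xa xp]; first by lia.
by rewrite eq_sym (negbTE ya) ltn_add2l IH.
Qed.

(** A letter [z] strictly between [x] and [y] gives a closer inversion: with [y] if it is in [p],
    with [x] if it is in [q]. An inversion of least difference therefore has none. *)
Lemma closest_inversion (p q : seq nat) (x0 y0 : nat) :
  x0 \in p -> y0 \in q -> y0 < x0 ->
  exists x y, [/\ x \in p, y \in q, y < x &
    {in p ++ q, forall z, (x < z) = (y < z) \/ z = x \/ z = y}].
Proof.
move: {2}(x0 - y0) (leqnn (x0 - y0)) => n.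
elim: n x0 y0 => [|n IH] x y n_le xp yq yx; first by lia.
case: (boolP (has (fun z => y < z < x) (p ++ q))) => [/hasP[z zpq zxy]|/hasPn none].
  move: zpq; rewrite mem_cat => /orP[zp|zq].
    by apply: (IH z y) => //; lia.
  by apply: (IH x z) => //; lia.
by exists x, y; split=> // z /none /=; lia.
Qed.

(** Inversions between the two words are removed one closest pair at a time; this stops because each
    removal lowers the sum of the letters of [p]. Sizes and [pdes] of the single words are recorded
    so that the hypotheses of shuffle-compatibility carry over. *)
Lemma separate_letters (i j : nat) (p q : seq nat) : uniq (p ++ q) ->
  exists p1 q1, [/\ uniq (p1 ++ q1), {in p1 & q1, forall x y, x < y},
    size p1 = size p /\ size q1 = size q,
    pdes i j p1 = pdes i j p /\ pdes i j q1 = pdes i j q &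
    perm_eq (map (pdes i j) (shuffles p q)) (map (pdes i j) (shuffles p1 q1))].
Proof.
have [n] := ubnP (sumn p); elim: n p q => // n IH p q le_n u.
have := u; rewrite cat_uniq => /and3P[_ /hasPn/= dis _].
case: (boolP (all (fun x => all (leq x) q) p)) => [/allP le_pq|/allPn[x0 x0p /allPn[y0 y0q]]].
  exists p, q; split=> // x y xp yq; have /allP/(_ _ yq) := le_pq _ xp.
  by rewrite leq_eqVlt => /orP[/eqP xy|//]; have := dis _ yq; rewrite -xy xp.
rewrite -ltnNge => lt0; have [x [y [xp yq yx btw]]] := closest_inversion x0p y0q lt0.
have yp : y \notin p := dis _ yq.
have xq : x \notin q by apply: contraTN xp => /dis.
have lt_sum := sumn_map_swap yx xp yp.
have [||p1] := IH (map (swap x y) p) (map (swap x y) q); first by lia.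
  by rewrite -map_cat (map_inj_uniq (@swap_inj x y)).
move=> [q1 [u1 lt1 [sp1 sq1] [dp1 dq1] pm]]; exists p1, q1.
(* Neither [p] nor [q] contains both letters, so the swap preserves [pdes] of each. *)
have nadj s : (x \notin s) || (y \notin s) -> ~~ adjacent x y s.
  by apply: contraL => /orP[] /mem_infix sub; rewrite negb_or !negbK !sub ?inE ?eqxx ?orbT.
split=> //; first by rewrite sp1 sq1 !size_map.
  rewrite dp1 dq1 !pdes_map_swap ?nadj ?yp ?xq ?orbT //.
    by move=> z zq; apply: btw; rewrite mem_cat zq orbT.
  by move=> z zp; apply: btw; rewrite mem_cat zp.
exact: perm_trans (perm_pdes_exchange i j u xp yq btw) pm.
Qed.

(** * Renaming the letters of separated words *)

(** Letters that are neighbours in [t] have nothing between them in [s] either. The two inequalities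
    bound the distances to both ends, so a position in the window of [t] yields one in the window of
    [s]. *)
Lemma subseq_adjacent (s t : seq nat) (k : nat) :
  uniq t -> subseq s t -> k.+1 < size t ->
  nth 0 t k \in s -> nth 0 t k.+1 \in s ->
  exists2 l, nth 0 s l = nth 0 t k /\ nth 0 s l.+1 = nth 0 t k.+1 &
    [/\ l.+1 < size s, l <= k & size s - l.+1 <= size t - k.+1].
Proof.
move=> ut /subseq_uniqP-/(_ ut) sE kt ks kSs.
(* [A] and [B] collect the letters of [s] before and after the pair, so the index sought in [s] is
   [size A]. *)
set A := filter (mem s) (take k t); set B := filter (mem s) (drop k.+2 t).
have e : s = A ++ [:: nth 0 t k, nth 0 t k.+1 & B].
  by rewrite {1}sE {1}(pair_in_seq kt) !filter_cat /= ks kSs.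
have leA : size A <= k.
  by rewrite size_filter (leq_trans (count_size _ _)) // size_take_min geq_minl.
have leB : size B <= size t - k.+2.
  by rewrite size_filter (leq_trans (count_size _ _)) // size_drop.
have es : size s = size A + (size B).+2 by rewrite {1}e size_cat.
exists (size A); last by clearbody A B; clear -leA leB es kt; split; lia.
by rewrite e !nth_cat ltnn subnn ltnNge leqnSn subSnn.
Qed.

(** Letters correspond by position in the two words, not by value. *)
Definition rename (s s' : seq nat) (z : nat) : nat := nth 0 s' (index z s).

Lemma renameK (s s' : seq nat) : uniq s' -> size s = size s' ->
  {in s, cancel (rename s s') (rename s' s)}.
Proof.
by move=> us ss z zs; rewrite /rename index_uniq ?nth_index // -ss index_mem.
Qed.

Lemma map_rename (s s' : seq nat) : uniq s -> size s = size s' ->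
  map (rename s s') s = s'.
Proof.
move=> us ss; apply: (@eq_from_nth _ 0); rewrite size_map // => k ks.
by rewrite (nth_map 0) // /rename index_uniq.
Qed.

Lemma map_rename_cat (p q p' q' : seq nat) :
  uniq (p ++ q) -> size p = size p' -> size q = size q' ->
  map (rename (p ++ q) (p' ++ q')) p = p' /\ map (rename (p ++ q) (p' ++ q')) q = q'.
Proof.
move=> u sp sq; have := @map_rename (p ++ q) (p' ++ q') u.
by rewrite !size_cat sp sq map_cat => /(_ erefl)/eqP;
  rewrite eqseq_cat ?size_map // => /andP[/eqP-> /eqP->].
Qed.

Lemma mem_rename_shuffles (p q p' q' t : seq nat) :
  uniq (p ++ q) -> size p = size p' -> size q = size q' -> t \in shuffles p q ->
  map (rename (p ++ q) (p' ++ q')) t \in shuffles p' q'.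
Proof.
move=> u sp sq; have [ep eq] := map_rename_cat u sp sq.
rewrite !mem_filter !mem_permutations => /andP[/andP[pt qt] e].
set h := rename _ _ in ep eq *.
by rewrite -ep -eq -map_cat !map_subseq // perm_map.
Qed.

Lemma pdes_rename (i j : nat) (p q p' q' t : seq nat) :
  uniq (p ++ q) -> size p = size p' -> size q = size q' ->
  {in p & q, forall x y, x < y} -> {in p' & q', forall x y, x < y} ->
  pdes i j p = pdes i j p' -> pdes i j q = pdes i j q' ->
  t \in shuffles p q ->
  pdes i j (map (rename (p ++ q) (p' ++ q')) t) = pdes i j t.
Proof.
move=> u sp sq lt lt' dp dq tpq; have ut := shuffles_uniq u tpq.
have [ep eq] := map_rename_cat u sp sq.
move: tpq; rewrite mem_filter mem_permutations => /andP[/andP[pt qt] /perm_mem e].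
apply/esym/pdesP; first by rewrite size_map.
move=> k kt kw; rewrite !(nth_map 0) ?(ltnW kt) //.
set h := rename _ _ in ep eq *.
(* Two neighbours from the same word [s] are neighbours in [s], where the equality of [pdes]
   compares them. *)
have within s s' : subseq s t -> map h s = s' -> pdes i j s = pdes i j s' ->
    nth 0 t k \in s -> nth 0 t k.+1 \in s ->
    (nth 0 t k.+1 < nth 0 t k) = (h (nth 0 t k.+1) < h (nth 0 t k)).
  move=> st es ds ks kSs.
  have [l [<- <-] [ls lk le_tail]] := subseq_adjacent ut st kt ks kSs.
  have ss : size s = size s' by rewrite -es size_map.
  have /(pdesP i j ss)/(_ l ls) -> := ds; first by rewrite -es !(nth_map 0) ?(ltnW ls).
  by move: kw; rewrite /in_window; lia.
have hp z : z \in p -> h z \in p' by move=> zp; rewrite -ep map_f.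
have hq z : z \in q -> h z \in q' by move=> zq; rewrite -eq map_f.
have := mem_nth 0 kt; have := mem_nth 0 (ltnW kt); rewrite !e !mem_cat.
(* In the two mixed cases, the words that the letters come from decide the comparison, before and
   after renaming alike. *)
move=> /orP[ap|aq] /orP[bp|bq].
- exact: within pt ep dp ap bp.
- by rewrite ltnNge (ltnW (lt _ _ ap bq)) ltnNge (ltnW (lt' _ _ (hp _ ap) (hq _ bq))).
- by rewrite (lt _ _ bp aq) (lt' _ _ (hp _ bp) (hq _ aq)).
- exact: within qt eq dq aq bq.
Qed.

Theorem theorem2p9 (i j : nat) : shuffle_compatible (partial_Des i j).
Proof.
move=> p q p' q' /andP[up _] /andP[uq _] dpq /andP[up' _] /andP[uq' _] dpq' /=.
move=> dp dq sp sq.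
have u : uniq (p ++ q) by rewrite cat_uniq up uq andbT.
have u' : uniq (p' ++ q') by rewrite cat_uniq up' uq' andbT.
have [p1 [q1 [u1 lt1 [sp1 sq1] [dp1 dq1] pm1]]] := separate_letters i j u.
have [p2 [q2 [u2 lt2 [sp2 sq2] [dp2 dq2] pm2]]] := separate_letters i j u'.
rewrite (permPl pm1) (permPr pm2).
have sp12 : size p1 = size p2 by rewrite sp1 sp2.
have sq12 : size q1 = size q2 by rewrite sq1 sq2.
have s12 : size (p1 ++ q1) = size (p2 ++ q2) by rewrite !size_cat sp12 sq12.
have sub a b t : t \in shuffles a b -> {subset t <= a ++ b}.
  by rewrite mem_filter mem_permutations => /andP[_ /perm_mem e] z; rewrite e.
(* Between the separated pairs, renaming by position is the bijection, and renaming in the other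
   direction is its inverse. *)
apply: (@perm_map_inverse _ _ (map (rename (p1 ++ q1) (p2 ++ q2)))
  (map (rename (p2 ++ q2) (p1 ++ q1)))); rewrite ?uniq_shuffles //.
- by move=> t; apply: mem_rename_shuffles.
- by move=> t; apply: mem_rename_shuffles.
- by move=> t /sub/allP; apply: mapK_in; apply: renameK.
- by move=> t /sub/allP; apply: mapK_in; apply: renameK.
- by move=> t; apply: pdes_rename; rewrite // ?dp1 ?dp2 ?dq1 ?dq2.
Qed.
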